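(* Let $G$ be a clique tree in $\mathcal{CT}^{\geqslant 2}_{ev}$ with order $n$ and diameter $d=2k$ with $k\geqslant 2$, and let $C(G)=C(T_G)=\{z\}$. Then $\mathrm{rk}(\mathcal E(G))=2l$ and $\mathrm{In}(\mathcal E(G))=(l,l,n-2l)$, where $l:=|\mathcal D_G|$.
   Context: Graphs are finite, simple and undirected. A cut-vertex of a connected graph $G$ is a vertex whose removal disconnects $G$; a block of $G$ is a maximal connected subgraph $B$ having no cut-vertices of its own (no cut-vertex of $B$). A clique tree is a connected graph whose blocks are all complete graphs. $\mathcal{CT}$ is the class of clique trees $G$ such that each block of $G$ contains at most two cut-vertices of $G$. $\mathcal{CT}^{\geqslant 2}$ is the set of graphs in $\mathcal{CT}$ with diameter at least $2$, and $\mathcal{CT}^{\geqslant 2}_{ev}$ is the set of graphs in $\mathcal{CT}^{\geqslant 2}$ with even diameter. For a connected graph $G$, $d_G(u,v)$ is the distance and $e_G(u)=\max\{d_G(u,v)\mid v\in V_G\}$ the eccentricity of $u$. The center $C(G)$ is the set of vertices (called central vertices or centers) of minimum eccentricity. The eccentricity matrix $\mathcal E(G)=(\epsilon_{uv})$, indexed by $V_G\times V_G$, has $\epsilon_{uv}=d_G(u,v)$ if $d_G(u,v)=\min\{e_G(u),e_G(v)\}$ and $\epsilon_{uv}=0$ otherwise. The inertia of a real symmetric matrix $M$ is $\mathrm{In}(M)=(n_+(M),n_-(M),n_0(M))$, the numbers of positive, negative and zero eigenvalues of $M$ counted with multiplicity. For $G\in\mathcal{CT}^{\geqslant 2}$ a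 leaf-block is a block containing exactly one cut-vertex of $G$. Fix a labelling $v_1,\dots,v_n$ of $V_G$; let $\mathcal C_G$ be the set of cut-vertices of $G$, let $\mathcal S_G$ be the set obtained by picking in each leaf-block the noncut-vertex with minimal label, and let $T_G:=G[\mathcal C_G\cup\mathcal S_G]$ be the induced subgraph (the tree associated to $G$). A graph in $\mathcal{CT}^{\geqslant 2}_{ev}$ has exactly one central vertex $z$, and it is the center of $T_G$. A diametral path of $G$ is a shortest path between two vertices at distance $\mathrm{diam}(G)$. A vertex $v$ adjacent to the unique central vertex $z$ of $G$ is diametrally distinguished if some diametral path contains $v$; $\mathcal D_G$ is the set of diametrally distinguished vertices. *)

(* Defs.v *)
From HB Require Import structures.
From mathcomp Require Import all_boot all_order all_algebra.
From mathcomp Require Import polyrcf.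

Set Implicit Arguments.
Unset Strict Implicit.
Unset Printing Implicit Defensive.

Import Order.TTheory GRing.Theory Num.Theory.
Local Open Scope ring_scope.

Record sgraph := SGraph {
  svertex :> finType;
  sedge : rel svertex;
  sedge_sym : symmetric sedge;
  sedge_irr : irreflexive sedge }.

Section Metric.
Variable G : sgraph.
Implicit Types u v w : G.

Definition has_walk (m : nat) u v : bool :=
  [exists p : m.-tuple G, path (@sedge G) u p && (last u p == v)].

(* The least length of a walk from u to v; it is below #|G| as soon as u and v
   are connected, and #|G| is the (irrelevant) value for unconnected pairs. *)
Definition dist u v : nat := find (fun m => has_walk m u v) (iota 0 #|G|).

Definition ecc u : nat := (\max_(v : G) dist u v)%N.

Definition diam : nat := (\max_(u : G) ecc u)%N.

Definition center : {set G} := [set u | [forall v, (ecc u <= ecc v)%N]].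

Definition connected : bool := [forall u, forall v, connect (@sedge G) u v].

Definition diametral_path u (p : seq G) : bool :=
  [&& path (@sedge G) u p, size p == dist u (last u p)
    & dist u (last u p) == diam].

Definition distinguished (z : G) : {set G} :=
  [set v | sedge z v &&
     [exists u, exists p : diam.-tuple G, diametral_path u p && (v \in u :: p)]].

End Metric.

Section Subgraphs.
Variable G : sgraph.
Implicit Types (W S : {set G}) (F : {set {set G}}).

Definition edges_in W : {set {set G}} :=
  [set [set x; y] | x in W, y in W & sedge x y].

Definition sub_rel W F : rel {x : G | x \in W} :=
  [rel x y | sedge (val x) (val y) && ([set val x; val y] \in F)].

Lemma sub_rel_sym W F : symmetric (@sub_rel W F).
Proof. by move=> x y; rewrite /sub_rel /= sedge_sym setUC. Qed.

Lemma sub_rel_irr W F : irreflexive (@sub_rel W F).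
Proof. by move=> x; rewrite /sub_rel /= sedge_irr. Qed.

(* The graph with vertex set W and edge set F; it is only meant to be used for
   F \subset edges_in W. *)
Definition subgraph W F : sgraph :=
  SGraph (@sub_rel_sym W F) (@sub_rel_irr W F).

Definition induced W : sgraph := subgraph W (edges_in W).

End Subgraphs.

Definition cut_vertex (G : sgraph) (v : G) : bool :=
  ~~ connected (induced (~: [set v])).

Section CliqueTrees.
Variable G : sgraph.
Implicit Types (W : {set G}) (F : {set {set G}}).

Definition cut_vertices : {set G} := [set v | cut_vertex v].

Definition nonseparable W F : bool :=
  [&& F \subset edges_in W, connected (subgraph W F)
    & [forall x : subgraph W F, ~~ cut_vertex x]].

(* Maximality is with respect to the subgraph relation, so the edge set is
   part of the data of a block. *)
Definition block W F : bool :=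
  nonseparable W F &&
  [forall W', forall F',
     [&& nonseparable W' F', W \subset W' & F \subset F'] ==>
     (W' == W) && (F' == F)].

Definition complete W F : bool :=
  [forall x in W, forall y in W, (x != y) ==> ([set x; y] \in F)].

Definition clique_tree : Prop :=
  connected G /\ forall W F, block W F -> complete W F.

Definition CT : Prop :=
  clique_tree /\
  forall W F, block W F -> (#|W :&: cut_vertices| <= 2)%N.

Definition CT_ge2 : Prop := CT /\ (2 <= diam G)%N.

Definition CT_ge2_ev : Prop := CT_ge2 /\ ~~ odd (diam G).

Definition leaf_block W F : bool :=
  block W F && (#|W :&: cut_vertices| == 1)%N.

(* A labelling of the vertices is a bijection lab : 'I_n -> G. *)
Definition leaf_picks n (lab : 'I_n -> G) : {set G} :=
  [set lab i | i : 'I_n & [exists W, exists F,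
     [&& leaf_block W F, lab i \in W :\: cut_vertices
       & [forall j, (lab j \in W :\: cut_vertices) ==> (i <= j)%N]]]].

Definition assoc_tree n (lab : 'I_n -> G) : sgraph :=
  induced (cut_vertices :|: leaf_picks lab).

End CliqueTrees.

Definition ecc_entry (R : nzRingType) (G : sgraph) (u v : G) : R :=
  if dist u v == minn (ecc u) (ecc v) then (dist u v)%:R else 0.

Definition ecc_matrix (R : nzRingType) (G : sgraph) n (lab : 'I_n -> G) :
    'M[R]_n :=
  \matrix_(i, j) ecc_entry R (lab i) (lab j).

(* The number of eigenvalues in R satisfying P, counted with multiplicity;
   rootsR lists each root of a nonzero polynomial once. *)
Definition eig_count (R : rcfType) n (M : 'M[R]_n) (P : pred R) : nat :=
  (\sum_(x <- rootsR (char_poly M) | P x) mup x (char_poly M))%N.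

(* (n_+, n_-, n_0) *)
Definition inertia (R : rcfType) n (M : 'M[R]_n) : nat * nat * nat :=
  (eig_count M (fun x => 0 < x), eig_count M (fun x => x < 0),
   eig_count M (fun x => x == 0)).

(* Main.v *)
Require Import Defs.
From mathcomp Require Import all_boot all_order all_algebra.
From mathcomp Require Import complex polyrcf zify.

Set Implicit Arguments.
Unset Strict Implicit.
Unset Printing Implicit Defensive.

Import Order.TTheory GRing.Theory Num.Theory.

(* Call the components of G - z branches, and write h(u) = d(z, u).  If two
   neighbours of z lie in one branch, a path joining them avoiding z closes up
   to a cycle, which lies in a block, so they are adjacent.  Hence
   d(u, v) = h(u) + h(v) if and only if u and v are not in a common branch, and
   e(u) = h(u) + k.  So the entry at (u, v) is nonzero exactly when u and v are
   in different branches and one of them has h = k.  Setting b(u) = h(u) + k if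
   h(u) < k and b(u) = k if h(u) = k, this gives E = X Y^T + Y X^T, where, for
   each branch i reaching depth k, the column X_i is the indicator of the
   vertices of depth k in i and Y_i is b outside i and 0 on i.  Since the block
   of z inside a branch has at most one further cut-vertex, such branches
   correspond to the distinguished vertices.  Evaluating a linear relation at
   z, at the distinguished vertices and at depth k shows that the 2l columns of
   X and Y are independent, so E is congruent to l hyperbolic planes and a zero
   form. *)

(** * Symmetric matrices and their inertia *)

Section Inertia.
Local Open Scope ring_scope.
Local Open Scope sesquilinear_scope.

Lemma char_poly_similar (F : fieldType) n (A D U : 'M[F]_n) :
  U \in unitmx -> U *m A = D *m U -> char_poly A = char_poly D.
Proof.
move=> Uu UA; set Up := map_mx polyC U.
have E : Up *m char_poly_mx A = char_poly_mx D *m Up.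
  by rewrite mulmxBr mulmxBl -!map_mxM UA scalar_mxC.
have := congr1 determinant E; rewrite !det_mulmx mulrC.
apply: mulIf; rewrite det_map_mx polyC_eq0.
by move: Uu; rewrite unitmxE unitfE.
Qed.

(** The multiplicity of a root x is the number of i with d i = x; exchanging the sums counts each
    index once, as [rootsR] has no repetition. *)
Lemma eig_count_prod (R : rcfType) n (M : 'M[R]_n) (d : 'I_n -> R) (P : pred R) :
  char_poly M = \prod_i ('X - (d i)%:P) -> eig_count M P = #|[set i | P (d i)]|.
Proof.
move=> cM; have cM0 : char_poly M != 0 by rewrite monic_neq0 ?char_poly_monic.
have cM' : char_poly M = \prod_(y <- map d (enum 'I_n)) ('X - y%:P).
  by rewrite big_map big_enum.
have memR i : d i \in rootsR (char_poly M).
  by rewrite -roots_on_rootsR // inE cM' root_prod_XsubC map_f ?mem_enum.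
rewrite /eig_count.
under eq_bigr do rewrite cM' mu_prod_XsubC -sum1_count big_map big_enum_cond /=.
rewrite (exchange_big_dep (fun i => P (d i))) /= => [|x i Px /eqP->//].
rewrite -sum1dep_card; apply: eq_bigr => i Pdi.
rewrite -big_filter (eq_filter (a2 := pred1 (d i))).
  by rewrite filter_pred1_uniq ?memR ?big_seq1 ?uniq_roots.
move=> x /=; case: (d i =P x) => [<-|/eqP].
  by rewrite ?eqxx ?Pdi.
by rewrite eq_sym => /negPf->; rewrite andbF.
Qed.

(** The complexified matrix is Hermitian with real eigenvalues, and the factorization of its
    characteristic polynomial descends to [R] because the embedding into [R[i]] is injective. *)
Lemma symmetric_spectral (R : rcfType) n (M : 'M[R]_n) : M^T = M ->
  exists (U : 'M[R[i]]_n) (d : 'rV[R]_n),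
    [/\ U \is unitarymx, char_poly M = \prod_i ('X - (d 0 i)%:P) &
     map_mx (real_complex R) M
       = U^t* *m diag_mx (map_mx (real_complex R) d) *m U].
Proof.
move=> symM; set MC := map_mx _ M.
have hM : MC \is hermsymmx.
  apply: realsym_hermsym.
    by apply/is_hermitianmxP; rewrite expr0 scale1r map_mx_id // /MC map_trmx symM.
  by apply/mxOverP => i j; rewrite mxE complex_real.
set U := spectralmx MC.
have Uu : U \is unitarymx by exact: spectral_unitarymx.
have /orthomx_spectralP := hermitian_normalmx hM; rewrite -/U => eM.
pose d := map_mx (@complex.Re R) (spectral_diag MC).
have dE : map_mx (real_complex R) d = spectral_diag MC.
  apply/rowP => i; rewrite !mxE RRe_real //.
  exact: (mxOverP (hermitian_spectral_diag_real hM)).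
exists U, d; split=> //; last by rewrite dE -invmx_unitary.
apply: (@map_poly_inj _ _ (real_complex R)).
rewrite map_char_poly -/MC.
rewrite (@char_poly_similar _ _ _ (diag_mx (spectral_diag MC)) U).
- rewrite char_poly_trig ?diag_mx_is_trig // rmorph_prod /=.
  apply: eq_bigr => i _.
  by rewrite map_polyXsubC mxE eqxx mulr1n -dE mxE.
- exact: unitarymx_unit.
- by rewrite {1}eM !mulmxA mulmxV ?mul1mx // unitarymx_unit.
Qed.

(** The hypothesis makes the submatrix of columns in [S] row free, and its rank is at most its
    number of columns. *)
Lemma rows_le_support (F : fieldType) m n (W : 'M[F]_(m, n)) (S : {set 'I_n}) :
  (forall c : 'rV_m, (forall j, j \in S -> (c *m W) 0 j = 0) -> c = 0) ->
  (m <= #|S|)%N.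
Proof.
move=> inj; pose W' := colsub (fun j : 'I_#|S| => enum_val j) W.
suff /eqP <- : row_free W' by exact: rank_leq_col.
apply: inj_row_free => c cW; apply: inj => j jS.
transitivity ((c *m W') 0 (enum_rank_in jS j)); last by rewrite cW mxE.
by rewrite 2!mxE; apply: eq_bigr => i _; rewrite !mxE enum_rankK_in.
Qed.

(** One half of Sylvester's law: if c W vanishes on the positive coordinates, then a |c|^2 = sum_j
    d_j |(c W)_j|^2 <= 0, so c = 0. *)
Lemma definite_le_positive (C : numClosedFieldType) l n (W : 'M[C]_(l, n))
    (d : 'rV[C]_n) (a : C) :
  0 < a -> d \is a realmx -> W *m diag_mx d *m W^t* = a%:M ->
  (l <= #|[set i | (0 < d 0%R i)%R]|)%N.
Proof.
move=> a0 dR WdW; apply: (@rows_le_support _ _ _ W) => c cW.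
have E m p (e : 'rV[C]_p) (u : 'rV[C]_m) (A : 'M[C]_(m, p)) :
    (u *m (A *m diag_mx e *m A^t*) *m u^t*) 0 0
      = \sum_j e 0 j * `|(u *m A) 0 j| ^+ 2.
  rewrite !mulmxA -(mulmxA _ _ (u^t*)) -map_mxM -trmx_mul mxE.
  apply: eq_bigr => j _; rewrite mul_mx_diag !mxE -mulrA mulrCA.
  by rewrite normCK.
have := E _ _ d c W; rewrite WdW.
have -> : a%:M = 1%:M *m diag_mx (const_mx a) *m (1%:M)^t* :> 'M[C]_l.
  by rewrite mul1mx trmx1 map_mx1 mulmx1 diag_const_mx.
rewrite E mulmx1 => eq_sums.
have le0 : \sum_j d 0 j * `|(c *m W) 0 j| ^+ 2 <= 0.
  apply: sumr_le0 => j _; have [dj|] := boolP (0 < d 0 j).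
    by rewrite cW ?inE // normr0 expr0n mulr0.
  rewrite real_ltNge ?real0 ?(mxOverP dR) // negbK => dj.
  by rewrite mulr_le0_ge0 // exprn_ge0.
have ge0 j : 0 <= (const_mx a : 'rV_l) 0 j * `|c 0 j| ^+ 2.
  by rewrite mxE mulr_ge0 ?exprn_ge0 // ltW.
have /eqP : \sum_j (const_mx a : 'rV_l) 0 j * `|c 0 j| ^+ 2 = 0.
  by apply/eqP; rewrite eq_le sumr_ge0 // andbT eq_sums.
rewrite psumr_eq0 // => /allP c0; apply/rowP => j.
have := c0 j (mem_index_enum _); rewrite !mxE mulf_eq0 gt_eqF //=.
by rewrite sqrf_eq0 normr_eq0 => /eqP.
Qed.

Lemma rank_inertia_hyperbolic (R : rcfType) l n (X Y : 'M[R]_(n, l)) :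
  row_free (row_mx X Y)^T ->
  let M := X *m Y^T + Y *m X^T in
  \rank M = (2 * l)%N /\ inertia M = (l, l, (n - 2 * l)%N).
Proof.
move=> free M.
have MT : M^T = M by rewrite linearD /= !trmx_mul !trmxK addrC.
(* M is the product of [X Y] and the stacked blocks Y^T, X^T; both factors have rank 2l. *)
have free' : row_free (col_mx Y^T X^T).
  rewrite -row_leq_rank -addsmxE addsmxC addsmxE -tr_row_mx.
  by rewrite row_leq_rank.
have rkM : \rank M = (2 * l)%N.
  rewrite mul2n -addnn /M -mul_row_col mxrankMfree // -mxrank_tr.
  exact/eqP.
split=> //.
have [U [d [Uu cM eM]]] := symmetric_spectral MT.
set dC := map_mx _ d in eM.
have dR : dC \is a realmx by apply/mxOverP => i j; rewrite !mxE complex_real.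
rewrite /inertia !(eig_count_prod (d := d 0)) //.
set Sp := [set i | 0 < d 0 i]; set Sn := [set i | d 0 i < 0].
set S0 := [set i | d 0 i == 0].
(* [B^T] is a left inverse of [X Y], so V = [I, eI] B^T satisfies V X = I and V Y = eI, whence V M
   V^T = 2eI. *)
have [B AB] := row_freeP free.
(* A signed diagonal of the hyperbolic planes, on which the form is definite. *)
have dual (e : R) : exists V : 'M[R]_(l, n), V *m M *m V^T = (e + e)%:M.
  exists ((row_mx 1%:M e%:M) *m B^T).
  have : row_mx 1%:M e%:M *m B^T *m row_mx X Y = row_mx 1%:M e%:M.
    by rewrite -mulmxA -[X in B^T *m X]trmxK -trmx_mul AB trmx1 mulmx1.
  rewrite mul_mx_row => /eq_row_mx [VX VY].
  move: (_ *m B^T) VX VY => V VX VY.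
  rewrite mulmxDr mulmxDl !mulmxA VX VY -!mulmxA -!trmx_mul VX VY.
  by rewrite trmx1 tr_scalar_mx mul1mx mulmx1 -raddfD.
have definite (V : 'M[R]_(l, n)) (W := map_mx (real_complex R) V *m U^t*) :
    W *m diag_mx dC *m W^t* = map_mx (real_complex R) (V *m M *m V^T).
  rewrite !map_mxM eM /W !trmx_mul !map_mxM trmxCK !mulmxA.
  congr (_ *m _); apply/matrixP => i j; rewrite !mxE.
  by apply/CrealP; rewrite complex_real.
have lp : (l <= #|Sp|)%N.
  have [V eV] := dual 1.
  have -> : Sp = [set i | 0 < dC 0 i] by apply/setP => i; rewrite !inE mxE ltcR.
  apply: definite_le_positive dR (etrans (definite V) _); last first.
    by rewrite eV map_scalar_mx.
  by rewrite ltcR addr_gt0 ?ltr01.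
have ln : (l <= #|Sn|)%N.
  have [V eV] := dual (-1).
  have -> : Sn = [set i | 0 < (- dC) 0 i].
    by apply/setP => i; rewrite !inE !mxE oppr_gt0 ltcR.
  have ndR : - dC \is a realmx by apply/mxOverP => i j; rewrite mxE realN (mxOverP dR).
  apply: (@definite_le_positive _ _ _ (map_mx (real_complex R) V *m U^t*) _
            (1 + 1)%:C%C _ ndR).
    by rewrite ltcR addr_gt0 ?ltr01.
  rewrite [diag_mx _]raddfN mulmxN mulNmx definite eV map_scalar_mx -raddfN.
  by rewrite -rmorphN opprD opprK.
(* Written in the eigenbasis, the kernel of M is supported on the zero eigenvalues. *)
have l0 : (n - 2 * l <= #|S0|)%N.
  rewrite -rkM -mxrank_ker.
  pose K := row_base (kermx M).
  pose W := map_mx (real_complex R) K *m U^t*.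
  have Uunit : U^t* \in unitmx by rewrite unitarymx_unit ?trmxC_unitary.
  have WD : W *m diag_mx dC = 0.
    apply: (can_inj (mulmxK (unitarymx_unit Uu))); rewrite mul0mx /W.
    rewrite -!mulmxA [U^t* *m _]mulmxA -eM -map_mxM.
    suff -> : K *m M = 0 by rewrite map_mx0.
    by apply: sub_kermxP; rewrite eq_row_base.
  apply: (@rows_le_support _ _ _ W) => c cW.
  have Wfree : row_free W.
    by rewrite /row_free mxrankMfree ?row_free_unit // mxrank_map;
      apply: row_base_free.
  apply/eqP; rewrite -(mulmx_free_eq0 c Wfree); apply/eqP/rowP => j.
  rewrite [RHS]mxE; have [dj0|dj0] := eqVneq (d 0 j) 0.
    by rewrite cW // inE dj0.
  have := congr1 (fun A : 'rV_n => A 0 j) (mulmxA c W (diag_mx dC)).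
  rewrite WD mulmx0 mul_mx_diag !mxE => /esym/eqP.
  rewrite mulf_eq0 => /orP[/eqP //|].
  by rewrite (fmorph_eq0 (real_complex R)) (negPf dj0).
have total : (#|Sp| + #|Sn| + #|S0| = n)%N.
  rewrite -!sum1dep_card !(big_mkcond (fun _ => _ _)) /= -!big_split /=.
  rewrite -[RHS]card_ord -sum1_card; apply: eq_bigr => i _.
  by case: ltrgt0P.
(* The subtraction n - 2l is thus exact, so the three lower bounds add up to n and are
   equalities. *)
have le2l : (2 * l <= n)%N by rewrite -rkM rank_leq_row.
by congr (_, _, _); lia.
Qed.

End Inertia.

(** * Distances and branches *)

Section Distance.
Variable G : sgraph.
Hypothesis G_conn : connected G.
Implicit Types u v w x y : G.

(** A walk shorter than [dist u v] has a length in the searched range and would have been met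
    earlier by [find]. *)
Lemma dist_le_size u p : path (@sedge G) u p -> dist u (last u p) <= size p.
Proof.
move=> up; rewrite leqNgt; apply/negP => lt_p.
have p_lt : size p < #|G|.
  by apply: leq_trans lt_p _; rewrite -[X in _ <= X](size_iota 0) find_size.
have := before_find 0 lt_p; rewrite nth_iota // add0n => /existsP[].
by exists (in_tuple p); rewrite up eqxx.
Qed.

(** A simple path has fewer than #|G| edges, so the search in [dist] succeeds. *)
Lemma dist_path u v :
  exists p, [/\ path (@sedge G) u p, last u p = v & size p = dist u v].
Proof.
have /connectP[p up vE] : connect (@sedge G) u v.
  by have /forallP/(_ u)/forallP/(_ v) := G_conn.
case/shortenP: up vE => q uq uniq_q _ ->.
have has_q : has (fun m => has_walk m u (last u q)) (iota 0 #|G|).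
  apply/hasP; exists (size q).
    by rewrite mem_iota /= add0n -[_.+1]/(size (u :: q))
      -(card_uniqP uniq_q) max_card.
  by apply/existsP; exists (in_tuple q); rewrite uq eqxx.
have := nth_find 0 has_q; rewrite nth_iota; last first.
  by move: has_q; rewrite has_find size_iota.
by case/existsP => r /andP[ur /eqP rv]; exists r; rewrite ur rv size_tuple.
Qed.

Lemma dist0 u : dist u u = 0.
Proof. by apply/eqP; rewrite -leqn0; apply: (@dist_le_size u [::]). Qed.

Lemma dist_eq0 u v : dist u v = 0 -> u = v.
Proof. by have [p [_ <- <-]] := dist_path u v; move/size0nil->. Qed.

Lemma dist_edge u v : sedge u v -> dist u v <= 1.
Proof. by move=> uv; apply: (@dist_le_size u [:: v]); rewrite /= uv. Qed.

Lemma dist_triangle u v w : dist u w <= dist u v + dist v w.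
Proof.
have [p [up <- <-]] := dist_path u v.
have [q [vq <- <-]] := dist_path (last u p) w.
by rewrite -last_cat -size_cat dist_le_size // cat_path up.
Qed.

Lemma dist_sym u v : dist u v = dist v u.
Proof.
wlog suff le : u v / dist v u <= dist u v.
  by apply/eqP; rewrite eqn_leq !le.
have [p [up vE <-]] := dist_path u v.
have := @dist_le_size v (rev (belast u p)).
rewrite size_rev size_belast -vE rev_path.
rewrite (eq_path (e' := @sedge G)) ?up => [/(_ isT)|x y]; last exact: sedge_sym.
suff -> : last (last u p) (rev (belast u p)) = u by [].
by case: (p) => //= a q; rewrite rev_cons last_rcons.
Qed.

Lemma dist_step u v : u != v -> exists2 w, sedge u w & dist u v = (dist w v).+1.
Proof.
move=> uv; have [[|w p] /= [up vE sz]] := dist_path u v.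
  by rewrite vE eqxx in uv.
case/andP: up => uw wp; exists w => //; apply/eqP.
rewrite eqn_leq -[X in _ && (_ <= X)]sz ltnS -vE dist_le_size // vE andbT.
by rewrite -add1n (leq_trans (dist_triangle u w v)) ?leq_add2r ?dist_edge.
Qed.

Lemma dist_le_ecc u v : dist u v <= ecc u.
Proof. exact: (leq_bigmax_cond (F := dist u)). Qed.

Lemma ecc_le_diam u : ecc u <= diam G.
Proof. exact: (leq_bigmax_cond (F := @ecc G)). Qed.

Lemma ecc_attained u : exists v, dist u v = ecc u.
Proof.
have [|v _ eq_v] := @eq_bigmax_cond _ predT (dist u).
  by apply/card_gt0P; exists u.
by exists v; rewrite -eq_v.
Qed.

Lemma diam_attained u0 : exists u v : G, dist u v = diam G.
Proof.
have [|u _ eq_u] := @eq_bigmax_cond _ predT (@ecc G).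
  by apply/card_gt0P; exists u0.
by have [v uv] := ecc_attained u; exists u, v; rewrite uv -eq_u.
Qed.

Lemma eccE u m :
  (forall v, dist u v <= m) -> (exists v, dist u v = m) -> ecc u = m.
Proof.
move=> le_m [v vm]; apply/eqP; rewrite eqn_leq -{2}vm dist_le_ecc andbT.
by apply/bigmax_leqP => w _.
Qed.

End Distance.

Definition avoiding (G : sgraph) (z : G) : rel G :=
  [rel x y | [&& sedge x y, x != z & y != z]].

(* The component relation of G - z; the guard excludes the empty walk at z. *)
Definition same_branch (G : sgraph) (z u v : G) : bool :=
  (u != z) && connect (avoiding z) u v.

Section Branches.
Variable G : sgraph.
Hypothesis G_conn : connected G.
Implicit Types u v w x y z : G.

Lemma avoiding_sym z : symmetric (avoiding z).
Proof. by move=> x y; rewrite /avoiding /= sedge_sym [(x != z) && _]andbC. Qed.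

Lemma connect_avoiding_neq z u v : connect (avoiding z) u v -> u != z -> v != z.
Proof.
case/connectP => p; elim: p u => [|x p IH] u /= => [_ -> //|].
by case/andP=> /and3P[_ _ xz] xp vE _; apply: IH xp vE xz.
Qed.

Lemma same_branch_neql z u v : same_branch z u v -> u != z.
Proof. by case/andP. Qed.

Lemma same_branch_neqr z u v : same_branch z u v -> v != z.
Proof. by case/andP => uz /connect_avoiding_neq ->. Qed.

Lemma same_branch_refl z u : u != z -> same_branch z u u.
Proof. by move=> uz; rewrite /same_branch uz connect0. Qed.

Lemma same_branch_sym z u v : same_branch z u v = same_branch z v u.
Proof.
wlog suff imp : u v / same_branch z u v -> same_branch z v u.
  by apply/idP/idP; apply: imp.
move=> uv; rewrite /same_branch (same_branch_neqr uv) /=.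
by rewrite (sym_connect_sym (@avoiding_sym z)); case/andP: uv.
Qed.

Lemma same_branch_trans z v u w :
  same_branch z u v -> same_branch z v w -> same_branch z u w.
Proof.
by case/andP=> uz uv /andP[_ vw]; rewrite /same_branch uz (connect_trans uv).
Qed.

Lemma same_branch_edge z u v : sedge u v -> u != z -> v != z -> same_branch z u v.
Proof.
move=> uv uz vz; rewrite /same_branch uz.
by apply: connect1; rewrite /avoiding /= uv uz.
Qed.

(** Induction along a shortest path from u to v: until it meets z it stays in the branch of u, so it
    meets z before reaching v. *)
Lemma dist_through z u v : ~~ same_branch z u v -> dist u v = dist u z + dist z v.
Proof.
move=> nuv; apply/eqP; rewrite eqn_leq dist_triangle //=.
elim: (dist u v) {-2}u (erefl (dist u v)) nuv => [|m IH] {}u uvE nuv.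
  rewrite uvE; have uv := dist_eq0 G_conn uvE; move: nuv; rewrite -uv.
  by have [-> _|/same_branch_refl->//] := eqVneq u z; rewrite dist0.
have [->|uz] := eqVneq u z; first by rewrite dist0.
have uv : u != v by apply: contra_eq_neq uvE => ->; rewrite dist0.
have [w uw] := dist_step G_conn uv; rewrite uvE => -[] wvE.
have nwv : ~~ same_branch z w v.
  apply: contra nuv => wv; apply: (same_branch_trans _ wv).
  exact: same_branch_edge (same_branch_neql wv).
have := IH w (esym wvE) nwv; have := dist_edge uw.
by have := dist_triangle G_conn u w z; lia.
Qed.

(** Every vertex of a shortest path from u to v is closer to v than z is, so the path avoids z. *)
Lemma same_branch_closer z u v : dist u v < dist z v -> same_branch z u v.
Proof.
elim: (dist u v) {-2}u (erefl (dist u v)) => [|m IH] {}u uvE lt_uz.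
  have uv := dist_eq0 G_conn uvE; rewrite -uv same_branch_refl //.
  by apply: contraTneq lt_uz => ->; rewrite ltnn.
have uv : u != v by apply: contra_eq_neq uvE => ->; rewrite dist0.
have [w uw] := dist_step G_conn uv; rewrite uvE => -[] wvE.
have wv : same_branch z w v by apply: IH => //; lia.
apply: (same_branch_trans _ wv); apply: same_branch_edge (same_branch_neql wv) => //.
by apply: contraTneq lt_uz => ->; rewrite ltnn.
Qed.

Lemma branch_root z v : v != z ->
  exists x, [/\ sedge z x, dist z v = (dist x v).+1 & same_branch z x v].
Proof.
rewrite eq_sym => zv; have [x zx zvE] := dist_step G_conn zv.
exists x; split=> //.
by apply: same_branch_closer; rewrite zvE.
Qed.

Lemma separating_cut_vertex z u v :
  u != z -> v != z -> ~~ same_branch z u v -> cut_vertex z.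
Proof.
move=> uz vz; apply: contraNT => /negPn ncut.
have uW : u \in ~: [set z] by rewrite !inE.
have vW : v \in ~: [set z] by rewrite !inE.
have /forallP/(_ (exist _ u uW))/forallP/(_ (exist _ v vW)) := ncut.
rewrite /same_branch uz /= => /connectP[p].
suff H (x : induced (~: [set z])) (q : seq (induced (~: [set z]))) :
    path (@sedge _) x q -> connect (avoiding z) (val x) (val (last x q)).
  by move=> xq vE; have := H _ _ xq; rewrite -vE.
elim: q x => //= y q IH x /andP[/andP[xy _] /IH]; apply: connect_trans.
apply: connect1; rewrite /avoiding /= xy.
by have := valP x; have := valP y; rewrite !inE => -> ->.
Qed.

End Branches.

(** * Cycles and the blocks containing them *)

Section Cycles.
Variable G : sgraph.
Implicit Types (u v w x y z : G) (W A B : {set G}).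

(** A relation on [G] itself, which avoids the subtypes underlying [subgraph] and [induced]. *)
Definition within A : rel G := [rel x y | [&& sedge x y, x \in A & y \in A]].

Definition connected_within A : Prop :=
  {in A &, forall x y, connect (within A) x y}.

Lemma within_sym A : symmetric (within A).
Proof. by move=> x y; rewrite /within /= sedge_sym [(x \in A) && _]andbC. Qed.

Lemma connected_within_hub A w :
  (forall x, x \in A -> connect (within A) w x) -> connected_within A.
Proof.
move=> hub x y xA yA; apply: connect_trans (hub y yA).
by rewrite (sym_connect_sym (@within_sym A)) hub.
Qed.

Lemma path_within A x p : path (@sedge G) x p -> {subset x :: p <= A} ->
  forall y, y \in x :: p ->
  connect (within A) x y /\ connect (within A) y (last x p).
Proof.
elim: p x => [|a p IH] x /= xp sub y; first by rewrite inE => /eqP->.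
case/andP: xp => xa ap.
have sub' : {subset a :: p <= A} by move=> b bp; apply: sub; rewrite inE bp orbT.
have e_xa : connect (within A) x a.
  by apply: connect1; rewrite /within /= xa !sub // !inE eqxx ?orbT.
have [_ a_last] := IH a ap sub' a (mem_head _ _).
rewrite inE => /orP[/eqP->|yp]; first split.
  - exact: connect0.
  - exact: connect_trans a_last.
by have [ay ?] := IH a ap sub' y yp; split=> //; exact: connect_trans ay.
Qed.

(** Deleting a vertex of a subgraph nests two subtypes; paths under [within] are lifted through them
    edge by edge. *)
Lemma nonseparable_within W :
  connected_within W -> (forall w, w \in W -> connected_within (W :\ w)) ->
  nonseparable W (edges_in W).
Proof.
move=> conW conWw; apply/and3P; split=> //.
  apply/forallP => x; apply/forallP => y.
  have /connectP[p] := conW _ _ (valP x) (valP y).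
  elim: p x => [|a p IH] x /=; first by move=> _ /val_inj->.
  case/andP=> /and3P[xa xW aW] ap yE.
  have := IH (exist _ a aW) ap yE; apply: connect_trans; apply: connect1.
  by rewrite /= /sub_rel /= xa; apply/imset2P; exists (val x) a; rewrite ?inE ?aW.
apply/forallP => w; rewrite negbK.
apply/forallP => x; apply/forallP => y.
have xW : val (val x) \in W :\ val w.
  by rewrite !inE (valP (val x)) andbT; have := valP x; rewrite !inE.
have yW : val (val y) \in W :\ val w.
  by rewrite !inE (valP (val y)) andbT; have := valP y; rewrite !inE.
have /connectP[p] := conWw _ (valP w) _ _ xW yW.
elim: p x {xW} => [|a p IH] x /=; first by move=> _ /val_inj/val_inj->.
case/andP=> /and3P[xa xW aW] ap yE.
have aW' : a \in W by case/setD1P: aW.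
pose a1 : subgraph W (edges_in W) := exist _ a aW'.
have aw : a1 \in ~: [set w] by rewrite !inE; case/setD1P: aW.
pose a2 : induced (~: [set w]) := exist (fun b => b \in ~: [set w]) a1 aw.
have := IH a2 ap yE; apply: connect_trans; apply: connect1.
have xa1 : sedge (val x) a1.
  rewrite /= /sub_rel /= xa; apply/imset2P; exists (val (val x)) a => //.
    exact: (valP (val x)).
  by rewrite inE aW'.
rewrite /= {1}/sub_rel; apply/andP; split; first exact: xa1.
apply/imset2P; exists (val x) a1 => //; first exact: (valP x).
by rewrite inE aw.
Qed.

(** A nonseparable extension of (W, F) maximizing the number of vertices plus edges is a block. *)
Lemma block_of_nonseparable W F : nonseparable W F ->
  exists W' F', block W' F' /\ W \subset W'.
Proof.
move=> nWF.
pose P (X : {set G} * {set {set G}}) :=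
  [&& nonseparable X.1 X.2, W \subset X.1 & F \subset X.2].
have P0 : P (W, F) by rewrite /P /= nWF !subxx.
case: (@arg_maxnP _ (W, F) P (fun X => #|X.1| + #|X.2|) P0) => -[W' F'] /=.
case/and3P=> /= nWF' sW sF max; exists W', F'; split=> //.
rewrite /block nWF'; apply/forallP => W''; apply/forallP => F''; apply/implyP.
case/and3P=> n'' sW'' sF''.
have /= := max (W'', F''); rewrite /P /= n'' (subset_trans sW) // (subset_trans sF) //.
move=> /(_ isT) le.
have := subset_leq_card sW''; have := subset_leq_card sF'' => leF leW.
rewrite eq_sym eqEcard sW'' [F'' == _]eq_sym eqEcard sF'' /=; apply/andP; split.
  by rewrite -(leq_add2r #|F'|) (leq_trans _ le) // leq_add2l.
by rewrite -(leq_add2l #|W'|) (leq_trans _ le) // leq_add2r.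
Qed.

(* A path from x to y avoiding z closes up, through z, to a cycle. *)
Lemma block_through z x y : sedge z x -> sedge z y -> same_branch z x y ->
  exists W F, block W F /\ [/\ z \in W, x \in W & y \in W].
Proof.
move=> zx zy /andP[xz /connectP[p0 xp0]].
case/shortenP: xp0 => p xp uniq_p _ yE.
have xpG : path (@sedge G) x p by apply: sub_path xp => a b /and3P[].
have zp : z \notin x :: p.
  rewrite inE eq_sym negb_or xz /=; elim: (p) (x) xp {xz} => //= a q IH b.
  by case/andP=> /and3P[_ _ az] aq; rewrite inE negb_or eq_sym az (IH a).
pose W := z |: [set a in x :: p].
have inW a : a \in x :: p -> a \in W by move=> ap; rewrite !inE -in_cons ap orbT.
have xW : x \in W by apply/inW/mem_head.
have yW : y \in W by apply: inW; rewrite yE mem_last.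
have zW : z \in W by rewrite !inE eqxx.
suff nW : nonseparable W (edges_in W).
  have [W' [F' [bW' /subsetP sW]]] := block_of_nonseparable nW.
  by exists W', F'; split=> //; split; apply: sW.
apply: nonseparable_within.
  apply: (@connected_within_hub _ x) => a; rewrite in_setU1 => /orP[/eqP->|].
    by apply: connect1; rewrite /within /= sedge_sym zx xW zW.
  by rewrite inE => ap; have [] := path_within xpG inW ap.
move=> w; rewrite in_setU1 => /orP[/eqP->|].
  have sub : {subset x :: p <= W :\ z}.
    by move=> a ap; rewrite in_setD1 inW // andbT; apply: contraNneq zp => <-.
  apply: (@connected_within_hub _ x) => a.
  rewrite in_setD1 in_setU1 => /andP[/negPf-> /=].
  by rewrite inE => ap; have [] := path_within xpG sub ap.
(* Without w, the part of the path before w is joined to z through x, and the part after w through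
   y. *)
rewrite inE => wp; apply: (@connected_within_hub _ z) => a.
rewrite in_setD1 in_setU1 => /andP[aw] /orP[/eqP->|]; first exact: connect0.
have wz : z != w by apply: contraNneq zp => ->.
have zWw : z \in W :\ w by rewrite in_setD1 wz zW.
rewrite inE => ap.
have [p1 [p2 sE]] : exists p1 p2, x :: p = p1 ++ w :: p2.
  by case/splitPr: wp => p1 p2; exists p1, p2.
have yE' : y = last z (x :: p) by rewrite yE.
have sorted_xp : sorted (@sedge G) (x :: p) by [].
have inWw b : b \in p1 ++ p2 -> b \in W :\ w.
  move=> bp; have bw : b != w.
    move: uniq_p; rewrite sE -cat1s uniq_catCA cat1s /= => /andP[wp12 _].
    by apply: contraNneq wp12 => <-.
  by rewrite in_setD1 bw inW // sE mem_cat inE orbCA -mem_cat bp orbT.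
move: ap; rewrite sE mem_cat inE (negPf aw) /= => /orP[].
  case: p1 => // b p1 in sE inWw sorted_xp *; case: (sE) => bE _ ap1.
  rewrite sE in sorted_xp; have [bp1 _] := cat_sorted2 sorted_xp.
  have sub : {subset b :: p1 <= W :\ w}.
    by move=> c cp1; rewrite inWw // mem_cat cp1.
  have [ba _] := path_within bp1 sub ap1; apply: connect_trans ba.
  by apply: connect1; rewrite /within /= -bE zx zWw inWw // bE mem_head.
case: p2 => // b p2 in sE inWw *; rewrite sE in sorted_xp yE'.
have [_] := cat_sorted2 sorted_xp; rewrite /= => /andP[_ bp2] ap2.
have sub : {subset b :: p2 <= W :\ w}.
  by move=> c cp2; rewrite inWw // mem_cat cp2 orbT.
have [_ ay] := path_within bp2 sub ap2.
rewrite (sym_connect_sym (@within_sym _)); apply: connect_trans ay _.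
rewrite last_cat /= in yE'; rewrite -yE'; apply: connect1.
by rewrite /within /= sedge_sym zy zWw inWw // yE' mem_cat mem_last orbT.
Qed.

End Cycles.

(** * Clique trees *)

Section CliqueTreeGeometry.
Variable G : sgraph.
Hypothesis G_conn : connected G.
Implicit Types a b m u v w x y z : G.

Lemma dist_between u v i : i <= dist u v ->
  exists2 m, dist u m = i & dist m v = dist u v - i.
Proof.
elim: i => [|i IH] le_i; first by exists u; rewrite ?dist0 ?subn0.
have [m um mv] := IH (ltnW le_i).
have mv_neq : m != v.
  by apply: contraTneq le_i => mvE; move: mv; rewrite mvE dist0; lia.
have [x mx] := dist_step G_conn mv_neq; rewrite mv => xv.
exists x; last by lia.
have := dist_triangle G_conn u m x; have := dist_edge mx.
by have := dist_triangle G_conn u x v; lia.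
Qed.

Lemma dist_along u p v : path (@sedge G) u p -> v \in u :: p ->
  dist u v + dist v (last u p) <= size p.
Proof.
move=> up vp; case/splitPl: vp up => p1 p2 <-; rewrite cat_path last_cat size_cat.
by case/andP=> up1 vp2; rewrite leq_add ?dist_le_size.
Qed.

Hypothesis G_complete : forall (W : {set G}) F, block W F -> complete W F.

(** Some block contains z, x and y, and it is complete. *)
Lemma same_branch_adj z x y : sedge z x -> sedge z y -> same_branch z x y ->
  x != y -> sedge x y.
Proof.
move=> zx zy xy neq; have [W [F [bW [zW xW yW]]]] := block_through zx zy xy.
have /forallP/(_ x)/implyP/(_ xW) := G_complete bW.
move/forallP/(_ y)/implyP/(_ yW)/implyP/(_ neq).
have /andP[/and3P[/subsetP sF _ _] _] := bW.
move/sF => /imset2P[s t _]; rewrite inE => /andP[_ st] E.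
have := set21 x y; have := set22 x y; rewrite E !inE.
case/orP=> /eqP yE /orP[]/eqP xE; move: neq; rewrite xE yE ?eqxx //.
by rewrite sedge_sym.
Qed.

(** Shortest paths from z to u and v start with x and y, which are equal or adjacent; so d(u, v) <=
    (d(z, u) - 1) + 1 + (d(z, v) - 1). *)
Lemma dist_same_branch z u v : same_branch z u v -> dist u v < dist u z + dist z v.
Proof.
move=> uv; have [x [zx zuE xu]] := branch_root G_conn (same_branch_neql uv).
have [y [zy zvE yv]] := branch_root G_conn (same_branch_neqr uv).
have xy : same_branch z x y.
  by rewrite (same_branch_trans (same_branch_trans xu uv)) // same_branch_sym.
have le_xy : dist x y <= 1.
  have [->|neq] := eqVneq x y; first by rewrite dist0.
  by rewrite dist_edge // (same_branch_adj zx zy).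
have := dist_triangle G_conn u x v; have := dist_triangle G_conn x y v.
by rewrite (dist_sym G_conn u z) (dist_sym G_conn u x); lia.
Qed.

Lemma separated_branches m a b :
  dist a b = dist a m + dist m b -> ~~ same_branch m a b.
Proof. by move=> E; apply/negP => /dist_same_branch; rewrite E ltnn. Qed.

(** * The center and the eccentricities *)

Variable k : nat.
Hypothesis diamG : diam G = 2 * k.

Lemma dist_le_diam u v : dist u v <= 2 * k.
Proof. by rewrite -diamG (leq_trans (dist_le_ecc u v)) ?ecc_le_diam. Qed.

(** Each v misses the branch at m of a or of b, so k + d(m, v) is a distance and is at most 2k. *)
Lemma ecc_midpoint m a b :
  dist a m = k -> dist m b = k -> dist a b = 2 * k -> ecc m = k.
Proof.
move=> am mb ab; apply: eccE; last by exists b.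
move=> v; have nab : ~~ same_branch m a b by apply: separated_branches; lia.
have [av|av] := boolP (same_branch m a v).
  have /(dist_through G_conn) : ~~ same_branch m b v.
    apply: contra nab => bv; apply: same_branch_trans av _.
    by rewrite same_branch_sym.
  by have := dist_le_diam b v; rewrite (dist_sym G_conn b m); lia.
by have := dist_through G_conn av; have := dist_le_diam a v; lia.
Qed.

Variable z : G.
Hypothesis centerG : center G = [set z].

(** Every v satisfies 2k <= d(a, v) + d(v, b) <= 2 e(v), so e(m) = k is minimal. *)
Lemma midpoint_center m a b :
  dist a m = k -> dist m b = k -> dist a b = 2 * k -> m = z.
Proof.
move=> am mb ab; apply/set1P; rewrite -centerG inE; apply/forallP => v.
rewrite (ecc_midpoint am mb ab); have := dist_triangle G_conn a v b.
have := dist_le_ecc v a; have := dist_le_ecc v b.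
by rewrite (dist_sym G_conn a v); lia.
Qed.

Lemma antipodal_pair :
  exists a b, [/\ dist a z = k, dist z b = k & dist a b = 2 * k].
Proof.
have [a [b ab]] := diam_attained z; rewrite diamG in ab.
have [|m am mb] := @dist_between a b k; first by lia.
have mb' : dist m b = k by lia.
by exists a, b; rewrite -(midpoint_center am mb' ab).
Qed.

Lemma ecc_center : ecc z = k.
Proof. by have [a [b [az zb ab]]] := antipodal_pair; apply: ecc_midpoint ab. Qed.

Lemma dist_center_le u : dist z u <= k.
Proof. by rewrite -ecc_center dist_le_ecc. Qed.

(** The ends of a diametral path lie in different branches, so u misses one of them; this includes u
    = z. *)
Lemma opposite_deep u : exists2 c, dist z c = k & ~~ same_branch z u c.
Proof.
have [a [b [az zb ab]]] := antipodal_pair.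
have nab : ~~ same_branch z a b by apply: separated_branches; lia.
have [ua|ua] := boolP (same_branch z u a); last first.
  by exists a; rewrite // dist_sym.
exists b => //; apply: contra nab; apply: same_branch_trans.
by rewrite same_branch_sym.
Qed.

Lemma ecc_via_center u : ecc u = dist z u + k.
Proof.
apply: eccE => [v|]; last first.
  have [c zc /(dist_through G_conn) uc] := opposite_deep u; exists c.
  by rewrite uc zc dist_sym.
have := dist_triangle G_conn u z v; have := dist_center_le v.
by rewrite (dist_sym G_conn u z); lia.
Qed.

Lemma distinguishedP v :
  reflect (sedge z v /\ exists2 u, dist z u = k & (dist v u).+1 = k)
          (v \in distinguished z).
Proof.
rewrite inE; apply: (iffP andP) => -[zv].
  case/existsP=> u /existsP[p /andP[/and3P[up /eqP szp /eqP dp] vp]]; split=> //.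
  move: {p}(tval p) up szp dp vp => p up szp dp vp.
  have := dist_along up vp; rewrite szp dp diamG; set w := last u p in dp *.
  rewrite diamG in dp => le_uvw.
  have := dist_triangle G_conn u z w; have := dist_triangle G_conn u v w.
  have := dist_center_le u; have := dist_center_le w => zw zu.
  have := dist_triangle G_conn z v u; have := dist_triangle G_conn z v w.
  have := dist_edge zv; rewrite (dist_sym G_conn v u) (dist_sym G_conn u z).
  have [lt_uv|le_uv] := ltnP (dist u v) k.
    by exists u; rewrite ?(dist_sym G_conn v u); lia.
  have [lt_vw|le_vw] := ltnP (dist v w) k; first by exists w; lia.
  (* With both ends at distance at least k, v is the midpoint of the path. *)
  have vE : v = z by apply: (@midpoint_center v u w); lia.
  by rewrite vE sedge_irr in zv.
case=> u zu vu; split=> //; apply/existsP; exists u.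
(* The diametral path goes from u to v, on to z, then to c in another branch; its length is (k - 1)
   + 1 + k. *)
have [c zc uc] := opposite_deep u.
have [p1 [up1 vE sz1]] := dist_path G_conn u v.
have [q [zq cE szq]] := dist_path G_conn z c.
have sz : size (p1 ++ z :: q) == diam G.
  by rewrite size_cat /= sz1 szq (dist_sym G_conn u v) diamG; lia.
apply/existsP; exists (Tuple sz); rewrite /diametral_path /= last_cat /= cE (eqP sz).
rewrite (dist_through G_conn uc) (dist_sym G_conn u z) zu zc diamG addnn -mul2n eqxx.
by rewrite cat_path up1 /= vE sedge_sym zv zq -vE -cat_cons mem_cat mem_last.
Qed.

Lemma distinguished_root u : 0 < k -> dist z u = k ->
  exists2 v, v \in distinguished z & same_branch z v u.
Proof.
move=> k0 zu; have uz : u != z by apply: contraTneq k0 => uE; rewrite -zu uE dist0.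
have [v [zv zuE vu]] := branch_root G_conn uz; exists v => //.
by apply/distinguishedP; split=> //; exists u; lia.
Qed.

(** * Distinguished vertices and the decomposition of the entries *)

Hypothesis two_cuts :
  forall (W : {set G}) F, block W F -> #|W :&: cut_vertices G| <= 2.
Hypothesis k_ge2 : 2 <= k.

(** Otherwise v, w and z would be three cut-vertices in one block. *)
Lemma distinguished_inj v w : v \in distinguished z -> w \in distinguished z ->
  same_branch z v w -> v = w.
Proof.
(* A distinguished x lies on a shortest path from z to a deep u, so it separates them; k >= 2 makes
   u differ from x. *)
have cutD x : x \in distinguished z -> cut_vertex x.
  case/distinguishedP => zx [u zu xu]; have := dist_edge zx => le1.
  have nzu : ~~ same_branch x z u by apply/negP => /dist_same_branch; lia.
  apply: separating_cut_vertex nzu; first by apply: contraTneq zx => ->; rewrite sedge_irr.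
  by apply: contra_eq_neq xu => ->; rewrite dist0; lia.
have cutz : cut_vertex z.
  have [a [b [az zb ab]]] := antipodal_pair.
  have nab : ~~ same_branch z a b by apply: separated_branches; lia.
  by apply: separating_cut_vertex nab; [apply: contra_eq_neq az|apply: contra_eq_neq zb] => ->;
    rewrite dist0; lia.
move=> vD wD vw; have [zv _] := distinguishedP v vD.
have [zw _] := distinguishedP w wD.
apply/eqP; apply: contraT => neq.
have [W [F [bW [zW vW wW]]]] := block_through zv zw vw.
have := two_cuts bW; suff : 3 <= #|W :&: cut_vertices G| by lia.
have sub : z |: [set v; w] \subset W :&: cut_vertices G.
  apply/subsetP => x; rewrite !inE => /orP[/eqP->|/orP[]/eqP->].
  - by rewrite zW.
  - by rewrite vW cutD.
  - by rewrite wW cutD.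
apply: leq_trans (subset_leq_card sub); rewrite cardsU1 cards2 neq !inE negb_or.
by rewrite ![z == _]eq_sym (same_branch_neql vw) (same_branch_neqr vw).
Qed.

(* At depth k the weight is k rather than 2k, because two deep vertices in
   different branches receive a contribution from both summands of
   [ecc_entry_sum]. *)
Definition deep (i u : G) : nat := (dist z u == k) && same_branch z i u.

Definition weight (i u : G) : nat :=
  if same_branch z i u then 0 else if dist z u == k then k else dist z u + k.

(** For deep u, only the distinguished vertex in the branch of u can contribute, and [weight i v]
    depends on i only through its branch. *)
Lemma sum_deep_weight u v :
  \sum_(i in distinguished z) deep i u * weight i v =
  if (dist z u == k) && ~~ same_branch z u v then
    if dist z v == k then k else dist z v + k
  else 0.
Proof.
have [zu|zu] := eqVneq (dist z u) k; last first.
  by rewrite big1 // => i _; rewrite /deep (negPf zu).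
have [|x xD xu] := distinguished_root _ zu; first by lia.
rewrite (bigD1 x) //= [X in _ + X]big1 => [|i /andP[iD ix]].
  rewrite /deep zu eqxx xu mul1n addn0 /weight.
  have -> : same_branch z x v = same_branch z u v; last by case: ifP.
  by apply/idP/idP; apply: same_branch_trans; rewrite // same_branch_sym.
rewrite /deep zu eqxx; case: (boolP (same_branch z i u)) => // iu.
case/eqP: ix; apply: distinguished_inj => //; apply: same_branch_trans iu _.
by rewrite same_branch_sym.
Qed.

(** Across branches, h(u) + h(v) equals min(e(u), e(v)) exactly when h(u) or h(v) is k; within a
    branch, d(u, v) is below that minimum. *)
Lemma ecc_entry_sum (R : nzRingType) u v :
  ecc_entry R u v =
  (\sum_(i in distinguished z)
      (deep i u * weight i v + weight i u * deep i v))%:R%R.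
Proof.
rewrite big_split /= [in X in _ + X](eq_bigr _ (fun i _ => mulnC (weight i u) _)).
rewrite !sum_deep_weight (same_branch_sym z v u) /ecc_entry !ecc_via_center.
have := dist_center_le u; have := dist_center_le v => zv zu.
have [uv|uv] := boolP (same_branch z u v).
  have := dist_same_branch uv; rewrite (dist_sym G_conn u z) !andbF => lt_uv.
  by case: eqP => //; lia.
rewrite (dist_through G_conn uv) (dist_sym G_conn u z) !andbT.
case: eqP => [E|E]; [congr (_%:R)%R|rewrite -[LHS]/(0%:R)%R; congr (_%:R)%R];
  by case: eqP => ?; case: eqP => ?; lia.
Qed.

Lemma deep_weight_free (R : rcfType) n (lab : 'I_n -> G)
    (lab_bij : bijective lab)
    (l := #|distinguished z|) :
  row_free (row_mx
    (\matrix_(j < n, i < l) (deep (enum_val i) (lab j))%:R%R : 'M[R]_(n, l))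
    (\matrix_(j < n, i < l) (weight (enum_val i) (lab j))%:R%R))^T%R.
Proof.
Local Open Scope ring_scope.
have [g _ labK] := lab_bij; apply: inj_row_free => w.
(* [al] and [be] are the coefficients of the [deep] and [weight] columns. *)
rewrite tr_row_mx -[w]hsubmxK mul_row_col; move: (lsubmx w) (rsubmx w) => al be E.
have at_ u : \sum_i al 0 i * (deep (enum_val i) u)%:R
           + \sum_i be 0 i * (weight (enum_val i) u)%:R = 0.
  have /rowP/(_ (g u)) := E; rewrite !mxE => Eu; rewrite -[RHS]Eu.
  by congr (_ + _); apply: eq_bigr => i _; rewrite !mxE labK.
(* Away from depth k the [deep] terms vanish, and the nonzero factor d(z, u) + k cancels. *)
have shallow u : dist z u != k ->
    \sum_i be 0 i * (~~ same_branch z (enum_val i) u)%:R = 0.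
  move=> zu; have := at_ u; rewrite big1 => [|i _]; last first.
    by rewrite /deep (negPf zu) mulr0.
  rewrite add0r => S0; apply/eqP.
  have zuk : ((dist z u + k)%N%:R : R) != 0 by rewrite pnatr_eq0; lia.
  rewrite -(mulIr_eq0 _ (mulIf zuk)) mulr_suml -[X in _ == X]S0; apply/eqP.
  apply: eq_bigr => i _; rewrite -mulrA -natrM /weight (negPf zu).
  by case: same_branch; rewrite ?mul0n ?mul1n.
have root_i (i : 'I_l) : enum_val i \in distinguished z := enum_valP i.
have branchE (i j : 'I_l) u : same_branch z (enum_val j) u ->
    same_branch z (enum_val i) u = (i == j).
  move=> ju; apply/idP/eqP => [iu|->//]; apply: enum_val_inj.
  apply: distinguished_inj => //; apply: same_branch_trans iu _.
  by rewrite same_branch_sym.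
(* The vertex z lies in no branch, so every coefficient survives there. *)
have sum_be : \sum_i be 0 i = 0.
  rewrite -[RHS](shallow z) ?dist0; last by lia.
  apply: eq_bigr => i _; case: (boolP (same_branch _ _ _)) => [/same_branch_neqr|].
    by rewrite eqxx.
  by rewrite mulr1.
(* At the distinguished vertex j, of depth 1 < k, all coefficients but that of j survive; comparison
   with the full sum isolates it. *)
have be0 : be = 0.
  apply/rowP => j; rewrite mxE.
  have [zj [u zu ju]] := distinguishedP _ (root_i j).
  have jz : enum_val j != z by apply: contraTneq zj => ->; rewrite sedge_irr.
  have := shallow (enum_val j); rewrite (bigD1 j) //= same_branch_refl //= mulr0 add0r.
  have -> : dist z (enum_val j) != k by have := dist_edge zj; lia.
  move=> /(_ isT) S0; move: sum_be; rewrite (bigD1 j) //=.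
  suff -> : \sum_(i | i != j) be 0 i = 0 by rewrite addr0.
  rewrite -[RHS]S0; apply: eq_bigr => i ij.
  by rewrite (branchE i j) ?same_branch_refl // (negPf ij) mulr1.
(* At a deep vertex in the branch of j, only the [deep] column of j is nonzero. *)
have al0 : al = 0.
  apply/rowP => j; rewrite mxE.
  have [zj [u zu ju]] := distinguishedP _ (root_i j).
  have ju' : same_branch z (enum_val j) u.
    by apply: same_branch_closer => //; rewrite zu; lia.
  have := at_ u; rewrite be0 [X in _ + X]big1 ?addr0 => [|i _]; last first.
    by rewrite mxE mul0r.
  rewrite (bigD1 j) //= /deep zu eqxx ju' mulr1 big1 ?addr0 // => i ij.
  by rewrite (branchE i j) // (negPf ij) mulr0.
by rewrite al0 be0 row_mx0.
Qed.

End CliqueTreeGeometry.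

Local Open Scope ring_scope.

Theorem theorem3p6 (R : rcfType) (G : sgraph) (n : nat) (lab : 'I_n -> G)
    (k : nat) (z : G)
    (lab_bij : bijective lab)
    (G_CT : CT_ge2_ev G)
    (diamG : diam G = (2 * k)%N)
    (k_ge2 : (2 <= k)%N)
    (centerG : center G = [set z])
    (centerT : [set val x | x in center (assoc_tree lab)] = [set z]) :
  let l := #|distinguished z| in
  \rank (ecc_matrix R lab) = (2 * l)%N /\
  inertia (ecc_matrix R lab) = (l, l, (n - 2 * l)%N).
Proof.
have [[[[G_conn G_complete] two_cuts] _] _] := G_CT; move=> l.
have free :=
  deep_weight_free G_conn G_complete diamG centerG two_cuts k_ge2 R lab_bij.
have := rank_inertia_hyperbolic free; set M := (_ + _).
(* Entrywise, X Y^T + Y X^T is the sum over distinguished vertices, reindexed by [enum_val]. *)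
suff -> : ecc_matrix R lab = M by [].
apply/matrixP => i j; rewrite !mxE.
rewrite (ecc_entry_sum G_conn G_complete diamG centerG two_cuts k_ge2) natr_sum.
rewrite big_enum_val -big_split; apply: eq_bigr => a _.
by rewrite !mxE natrD !natrM.
Qed.
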